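(* Let $Q_{12}=\langle a,b : a^6=1,\ b^2=a^3,\ ab=ba^{-1}\rangle$ be the dicyclic group of order $12$. Then $\mathcal S(Q_{12})$ is exactly the set of integers of the following forms, where $m$ ranges over all integers coprime to $6$: (i) $2^a3^bm$ with $a\in\{0,4\}$ or $a\ge 6$, and $b=0$ or $b\ge 3$; (ii) $2^5 3^b m$ with $b=4$ or $b\ge 6$; (iii) $2^5 3^b m k$ with $b\in\{0,3,5\}$, where $k$ is either a prime $p\equiv 5\pmod{12}$ or the square $p^2$ of a prime $p\equiv 5 \pmod 6$.
   Context: For a finite group $G=\{g_1,\dots,g_n\}$, assign an independent variable $x_g$ to each $g\in G$; the group determinant $\mathscr D_G(x_{g_1},\dots,x_{g_n})$ is the determinant of the $n\times n$ matrix whose $(i,j)$ entry is $x_{g_ig_j^{-1}}$. Define $\mathcal S(G)=\{\mathscr D_G(x_{g_1},\dots,x_{g_n}) : x_{g_i}\in\mathbb Z\}$.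
   Formalization: The integer 0 lies in S(Q_12) (take all variables 0) but has none of the forms (i)-(iii), since m coprime to 6 is nonzero; the formal theorem therefore says S(Q_12) consists of 0 together with the integers of forms (i)-(iii). *)

(* Defs.v *)
From mathcomp Require Import all_boot all_order all_fingroup all_algebra all_solvable.

Set Implicit Arguments.
Unset Strict Implicit.
Unset Printing Implicit Defensive.

Import GRing.Theory.
Local Open Scope ring_scope.

(* The elements of G are listed in the order of [enum G]. Another ordering
   permutes rows and columns simultaneously, so the determinant is the same.
   Only the values of x on G matter. *)
Definition group_det (R : comNzRingType) (gT : finGroupType) (G : {group gT})
    (x : gT -> R) : R :=
  \det (\matrix_(i < #|G|, j < #|G|) x (enum_val i * (enum_val j)^-1)%g).

Definition int_group_dets (gT : finGroupType) (G : {group gT}) (n : int) : Prop :=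
  exists x : gT -> int, n = group_det G x.

(* The relation [_ \isog Grp _] determines the group up to isomorphism. *)
Definition is_Q12 (gT : finGroupType) (G : {group gT}) : Prop :=
  (G \isog Grp (a : b : a ^+ 6 = 1, b ^+ 2 = a ^+ 3, a * b = b * a^-1))%g.

(* An m coprime to 6 is nonzero, so 0 (the determinant at x = 0) has none of
   the three forms below and must be listed separately. *)
Definition form_i (n : int) : Prop :=
  exists a b : nat, exists m : int,
    [/\ coprimez m 6,
        [\/ a = 0%N, a = 4%N | (6 <= a)%N],
        b = 0%N \/ (3 <= b)%N &
        n = 2 ^+ a * 3 ^+ b * m].

Definition form_ii (n : int) : Prop :=
  exists b : nat, exists m : int,
    [/\ coprimez m 6,
        b = 4%N \/ (6 <= b)%N &
        n = 2 ^+ 5 * 3 ^+ b * m].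

Definition form_iii (n : int) : Prop :=
  exists b p k : nat, exists m : int,
    [/\ coprimez m 6,
        [\/ b = 0%N, b = 3%N | b = 5%N],
        prime p,
        (k = p /\ p = 5 %[mod 12]) \/ (k = (p ^ 2)%N /\ p = 5 %[mod 6]) &
        n = 2 ^+ 5 * 3 ^+ b * m * k%:Z].

Section Existence.
Local Open Scope group_scope.

(* The group is the nontrivial semidirect product of <x> = Z/3 by <y> = Z/4,
   with a = x * y ^+ 2 and b = y. *)
Lemma is_Q12_exists :
  exists gT : finGroupType, exists G : {group gT}, is_Q12 G /\ #|G| = 12.
Proof.
exists (Extremal.gtype 3 4 2), [set: Extremal.gtype 3 4 2]%G.
split; last by rewrite Extremal.card.
have genl (rT : finGroupType) (x y : rT) : x \in <[x]> <*> <[y]>.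
  by rewrite mem_gen // inE cycle_id.
have genr (rT : finGroupType) (x y : rT) : y \in <[x]> <*> <[y]>.
  by rewrite joingC genl.
have isoK := @Grp_ext_dihedral 3 isT 4 isT isT.
move=> rT H; rewrite isoK; apply/existsP/existsP=> -[[u v]] /= /eqP[defH].
- move=> u3 v4 uv; have uv2 : commute u (v ^+ 2).
    by apply/commgP/conjg_fixP; rewrite expgS expg1 conjgM uv conjVg uv invgK.
  exists (u * v ^+ 2, v); rewrite !xpair_eqE; apply/and4P; split.
  + rewrite -defH eqEsubset !join_subG !cycle_subG.
    rewrite groupM ?groupX ?genl ?genr //=.
    by rewrite -{1}[u](mulgK (v ^+ 2)) groupM ?groupV ?groupX ?genl ?genr.
  + by rewrite expgMn // (expgM u 3 2) u3 -expgM (expgM v 4 3) v4 !expg1n mulg1.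
  + by rewrite expgMn // u3 mul1g -expgM (expgD v 4 2) v4 mul1g.
  have v2V : (v ^+ 2)^-1 = v ^+ 2 by apply/eqP; rewrite eq_invg_mul -expgD v4.
  rewrite -mulgA -expgSr expgS mulgA (conjgC u v) uv -mulgA invMg v2V.
  by rewrite (commuteV (commute_sym uv2)).
move=> u6 v2 uv.
have uE : v ^+ 2 * (u ^+ 2)^-1 = u by rewrite v2 (expgS u 2) mulgK.
exists (u ^+ 2, v); rewrite !xpair_eqE /=; apply/and4P; split.
- rewrite -defH eqEsubset !join_subG !cycle_subG.
  rewrite groupX ?genl ?genr //= andbT.
  by rewrite -{1}uE groupM ?groupV ?genl // groupX ?genr.
- by rewrite -(expgM u 2 3) u6.
- by rewrite (expgM v 2 2) v2 -(expgM u 3 2) u6.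
by rewrite conjXg /conjg uv mulKg expgVn.
Qed.

End Existence.

(* Main.v *)
Require Import Defs.
From mathcomp Require Import all_boot all_order all_fingroup all_algebra all_solvable.
From mathcomp Require Import all_field ring zify.

(* Splitting along the central involution a^3 turns the group matrix into
   [[U, V], [V, U]], of determinant det (U + V) * det (U - V), and both 6 x 6
   determinants factor. With s the sum of three coordinates and N the norm form
   x^2 + y^2 + z^2 - xy - xz - yz of Z[w], w a cube root of unity, the values are
     (s(u)^2 - s(v)^2) (N u - N v)^2 (s(u')^2 + s(v')^2) (N u' + N v')^2
   with u = u' and v = v' mod 2. As N = s^2 mod 3, congruences mod powers of 2
   and 3 restrict the exponents. If 2^5 divides the value exactly, then
   Q = s(u')^2 + s(v')^2 has odd 2-adic valuation; when 3 does not divide Q,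
   either the odd part of Q has a prime factor p = 2 mod 3, and p^2 | Q if
   p = 3 mod 4, or Q = 2 mod 3, so that B = N u' + N v' = 2 mod 3 has such a
   prime factor, which is squared in the value.

   Conversely the set of values is multiplicative, so it is enough to realise
   the integers coprime to 6, a few products of powers of 2 and 3, 32 p for
   p = 5 mod 12 and 32 p^2 for p = 5 mod 6; the last two families come from
   writing p as a sum of two squares, resp. of two norms from Z[w]. *)

Set Implicit Arguments.
Unset Strict Implicit.
Unset Printing Implicit Defensive.

Import Order.TTheory GRing.Theory Num.Theory.
Local Open Scope ring_scope.

Fixpoint laplace_det (R : comNzRingType) (n : nat) (F : nat -> nat -> R) : R :=
  if n is n'.+1 then
    foldr (fun j s => (-1) ^+ j * F 0%N j
                      * laplace_det n' (fun i k => F i.+1 (bump j k)) + s)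
          0 (iota 0 n)
  else 1.

Lemma laplace_detE (R : comNzRingType) n (F : nat -> nat -> R) :
  \det (\matrix_(i < n, j < n) F i j) = laplace_det n F.
Proof.
elim: n F => [|n IHn] F; first by rewrite det_mx00.
rewrite (expand_det_row _ ord0) -/(iota 0 n.+1).
under eq_bigr => j _.
  rewrite mxE /cofactor mulrA [F _ _ * _]mulrC add0n.
  have ->: row' ord0 (col' j (\matrix_(i < n.+1, j < n.+1) F i j)) =
          \matrix_(i < n, k < n) F i.+1 (bump j k).
    by apply/matrixP=> i k; rewrite !mxE.
  rewrite (IHn (fun i k => F i.+1 (bump j k))); over.
rewrite -(big_mkord xpredT (fun j => (-1) ^+ j * F 0%N j
                                     * laplace_det n (fun i k => F i.+1 (bump j k)))).
by rewrite unlock /index_iota subn0.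
Qed.

Definition tsum (R : comNzRingType) (u : nat -> R) : R := u 0%N + u 1%N + u 2%N.

Definition tnorm (R : comNzRingType) (u : nat -> R) : R :=
  u 0%N ^+ 2 + u 1%N ^+ 2 + u 2%N ^+ 2 - u 0%N * u 1%N - u 0%N * u 2%N - u 1%N * u 2%N.

Definition twisted_det (R : comNzRingType) (e : R) (u v : nat -> R) : R :=
  (tsum u ^+ 2 - e * tsum v ^+ 2) * (tnorm u - e * tnorm v) ^+ 2.

Definition twisted_entry (R : comNzRingType) (e : R) (u v : nat -> R) (i j : nat) : R :=
  nth 0 (nth [::]
    [:: [:: u 0%N; u 2%N; u 1%N; e * v 0%N; e * v 1%N; e * v 2%N];
        [:: u 1%N; u 0%N; u 2%N; e * v 2%N; e * v 0%N; e * v 1%N];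
        [:: u 2%N; u 1%N; u 0%N; e * v 1%N; e * v 2%N; e * v 0%N];
        [:: v 0%N; v 2%N; v 1%N; u 0%N; u 1%N; u 2%N];
        [:: v 1%N; v 0%N; v 2%N; u 2%N; u 0%N; u 1%N];
        [:: v 2%N; v 1%N; v 0%N; u 1%N; u 2%N; u 0%N]] i) j.

Lemma det_twisted_entry (R : comNzRingType) (e : R) (u v : nat -> R) :
  \det (\matrix_(i < 6, j < 6) twisted_entry e u v i j) = twisted_det e u v.
Proof.
rewrite laplace_detE /twisted_det /tsum /tnorm.
by cbv [laplace_det iota foldr bump nth addn leq subn eq_op twisted_entry] => /=; ring.
Qed.

Lemma det_block_swap (R : comNzRingType) n (U V : 'M[R]_n) :
  \det (block_mx U V V U) = \det (U + V) * \det (U - V).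
Proof.
have E: block_mx 1%:M 0 (- 1%:M) 1%:M *m block_mx U V V U *m block_mx 1%:M 0 1%:M 1%:M
  = block_mx (U + V) V 0 (U - V).
  rewrite !mulmx_block !mul1mx !mul0mx !mulmx1 !mulmx0 !mulNmx !mul1mx ?addr0 ?add0r.
  by rewrite addrA addrK addNr [- V + U]addrC.
move/(congr1 determinant): E.
by rewrite !det_mulmx det_ublock !det_lblock !det1 !mul1r mulr1.
Qed.

Lemma group_det_enum (R : comNzRingType) (gT : finGroupType) (G : {group gT})
    (x : gT -> R) n (h : 'I_n -> gT) :
  #|G| = n -> injective h -> (forall i, h i \in G) ->
  group_det G x = \det (\matrix_(i < n, j < n) x (h i * (h j)^-1)%g).
Proof.
move=> Gn; case: n / Gn h => h h_inj hG.
pose f i := enum_rank_in (group1 G) (h i).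
have fK i : enum_val (f i) = h i by rewrite enum_rankK_in.
have f_inj : injective f by move=> i j /(congr1 enum_val); rewrite !fK => /h_inj.
pose s := perm f_inj.
rewrite /group_det; set M := (X in \det X = _); set M' := (X in _ = \det X).
have -> : M' = row_perm s (col_perm s M).
  by apply/matrixP=> i j; rewrite !mxE !permE !fK.
rewrite row_permE col_permE !det_mulmx !det_perm odd_permV.
by rewrite [RHS]mulrC -mulrA -expr2 sqrr_sign mulr1.
Qed.

Lemma int_group_dets_mul (gT : finGroupType) (G : {group gT}) (m n : int) :
  int_group_dets G m -> int_group_dets G n -> int_group_dets G (m * n).
Proof.
case=> x -> [y ->].
exists (fun g => \sum_(h in G) x (g * h^-1)%g * y h).
rewrite /group_det -det_mulmx; congr (\det _); apply/matrixP=> i j; rewrite !mxE.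
have gG k : @enum_val _ (mem G) k \in G by exact: enum_valP.
rewrite (reindex_onto (fun k => enum_val k * (enum_val j)^-1)%g
           (fun h => enum_rank_in (group1 G) (h * enum_val j)%g)) /=; last first.
  by move=> h hG; rewrite enum_rankK_in ?groupM // mulgK.
apply: eq_big => k.
  by rewrite groupM ?groupV //= mulgKV enum_valK_in eqxx.
by move=> _; rewrite !mxE invMg invgK mulgA mulgKV.
Qed.

(* [u + p] and [u - p] run over the pairs of triples congruent mod 2. *)
Definition Q12_value (n : int) : Prop := exists u v p q : nat -> int,
  n = twisted_det 1 (fun i => u i + p i) (fun i => v i + q i)
      * twisted_det (-1) (fun i => u i - p i) (fun i => v i - q i).

(* [(s, k)] stands for b^s a^k. The last six words are the first six times the
   central involution a^3, and each half consists of cosets of <a^2>. *)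
Definition Q12_words : seq (bool * nat) :=
  [:: (false, 0%N); (false, 2%N); (false, 4%N); (true, 0%N); (true, 2%N); (true, 4%N);
      (false, 3%N); (false, 5%N); (false, 1%N); (true, 3%N); (true, 5%N); (true, 1%N)].

Definition Q12_div (p q : bool * nat) : bool * nat :=
  (p.1 (+) q.1,
   ((if q.1 then (if p.1 then 0 else 3) + q.2 + 6 - p.2 else p.2 + 6 - q.2) %% 6)%N).

Definition Q12_table : seq (seq nat) := Eval vm_compute in
  [seq [seq index (Q12_div p q) Q12_words | q <- Q12_words] | p <- Q12_words].

Lemma matrix_block (R : Type) m n (F : nat -> nat -> R) :
  (\matrix_(i < m + n, j < m + n) F i j) =
  block_mx (\matrix_(i, j) F i j) (\matrix_(i, j) F i (m + j)%N)
           (\matrix_(i, j) F (m + i)%N j) (\matrix_(i, j) F (m + i)%N (m + j)%N).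
Proof.
by rewrite -[LHS]submxK; congr block_mx; apply/matrixP=> i j; rewrite !mxE.
Qed.

Section Q12.
Local Open Scope group_scope.

Lemma is_Q12_gen (gT : finGroupType) (G : {group gT}) :
  is_Q12 G -> exists a b : gT,
    [/\ <[a]> <*> <[b]> = G, a ^+ 6 = 1, b ^+ 2 = a ^+ 3, a * b = b * a^-1 & #|G| = 12%N].
Proof.
move=> hG; have [rT [H [hH cH]]] := is_Q12_exists.
have /existsP[[a b] /= /eqP[defG a6 b2 ab]] :
    G \homg Grp (a : b : a ^+ 6 = 1, b ^+ 2 = a ^+ 3, a * b = b * a^-1).
  by rewrite -(hG _ G) homg_refl.
exists a, b; split=> //; have -> : 12%N = #|H| by rewrite cH.
apply/eqP; rewrite eqn_leq.
have GH : G \homg H by rewrite (hH _ G) -(hG _ G) homg_refl.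
have HG : H \homg G by rewrite (hG _ H) -(hH _ H) homg_refl.
by rewrite !leq_homg.
Qed.

Variables (gT : finGroupType) (G : {group gT}) (a b : gT).
Hypotheses (defG : <[a]> <*> <[b]> = G) (a6 : a ^+ 6 = 1) (b2 : b ^+ 2 = a ^+ 3).
Hypotheses (ab : a * b = b * a^-1) (oG : #|G| = 12%N).

Definition Q12_elt (p : bool * nat) : gT := b ^+ p.1 * a ^+ p.2.

Lemma Q12_elt_mod s k : Q12_elt (s, k %% 6)%N = Q12_elt (s, k).
Proof. by rewrite /Q12_elt /= expg_mod. Qed.

Lemma expg_subM6 k l : (l <= 6)%N -> a ^+ (k + 6 - l) = a ^+ k * a ^- l.
Proof.
move=> l6; apply: (mulIg (a ^+ l)).
by rewrite mulgKV -expgD subnK ?(leq_trans l6) ?leq_addl // expgD a6 mulg1.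
Qed.

Lemma expaM_b k : a ^+ k * b = b * a ^- k.
Proof.
elim: k => [|k IHk]; first by rewrite !expg0 invg1 mulg1 mul1g.
by rewrite [in LHS]expgS -mulgA IHk mulgA ab -mulgA -invMg -expgSr.
Qed.

Lemma Q12_eltV p q : (p.2 < 6)%N -> (q.2 < 6)%N ->
  Q12_elt p * (Q12_elt q)^-1 = Q12_elt (Q12_div p q).
Proof.
case: p q => [s k] [t l] /= /ltnW k6 /ltnW l6; rewrite Q12_elt_mod /Q12_elt /=.
have bV : b^-1 = b * a ^+ 3.
  by apply: (mulgI b); rewrite mulgV mulgA -expg2 b2 -expgD a6.
have aVa n : a ^+ n * b^-1 = b^-1 * a ^- n.
  by apply: invg_inj; rewrite !invMg !invgK expaM_b.
have bVa n : a ^- n * b^-1 = b^-1 * a ^+ n.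
  by rewrite -[RHS](mulKg (a ^+ n)) [a ^+ n * _]mulgA aVa mulgKV.
case: t => /=; last by rewrite addbF expg0 mul1g expg_subM6 // mulgA.
rewrite expg_subM6 // invMg bVa !mulgA -[_ * a ^+ k * _]mulgA aVa addbT.
have -> : b ^+ s * (b^-1 * a ^- k) * a ^+ l = b ^+ s * b^-1 * (a ^+ l * a ^- k).
  by rewrite -(commute_sym (commuteV (commuteX2 l k (commute_refl a)))) !mulgA.
case: s => /=; first by rewrite mulgV expg0 !mul1g.
by rewrite expg0 mul1g bV expg1 expgD !mulgA.
Qed.

Lemma Q12_words_cover g : g \in G -> g \in map Q12_elt Q12_words.
Proof.
have aJ : a ^ b = a^-1 by rewrite conjgE ab mulKg.
have nab : <[b]> \subset 'N(<[a]>).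
  by rewrite cycle_subG; apply/normP; rewrite -cycleJ aJ cycleV.
rewrite -defG norm_joinEr // => /mulsgP[x y /cycleP[k ->] /cycleP[l ->] ->].
have [s [n ->]] : exists s n, a ^+ k * b ^+ l = Q12_elt (s, n).
  elim: l => [|l [s [n IHl]]].
    by exists false, k; rewrite /Q12_elt /= !expg0 mulg1 mul1g.
  exists (~~ s), (s * 3 + 6 - n %% 6)%N.
  rewrite expgSr mulgA IHl -Q12_elt_mod /Q12_elt /=.
  rewrite expg_subM6 ?(ltnW (ltn_pmod _ _)) // -mulgA expaM_b !mulgA; congr (_ * _).
  case: s {IHl} => /=; last by rewrite mulg1 mul1g.
  by rewrite expg1 -expg2 b2 mul1g.
rewrite -Q12_elt_mod; apply: map_f.
have : (n %% 6 < 6)%N by rewrite ltn_pmod.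
by case: s (n %% 6)%N => -[|[|[|[|[|[|]]]]]].
Qed.

Definition Q12_enum (i : nat) : gT := Q12_elt (nth (false, 0%N) Q12_words i).

Lemma Q12_enum_uniq : uniq (map Q12_elt Q12_words).
Proof.
apply: (@leq_size_uniq _ (enum G)); first by rewrite enum_uniq.
  by move=> g; rewrite mem_enum; apply: Q12_words_cover.
by rewrite -cardE oG.
Qed.

Lemma group_det_Q12 (R : comNzRingType) (x : gT -> R) :
  let X (i : nat) := x (Q12_enum i) in
  (group_det G x =
     twisted_det 1 (fun i => X i + X (6 + i)%N) (fun i => X (3 + i)%N + X (9 + i)%N)
     * twisted_det (-1) (fun i => X i - X (6 + i)%N) (fun i => X (3 + i)%N - X (9 + i)%N))%R.
Proof.
move=> X.
pose F i j := X (nth 0%N (nth [::] Q12_table i) j).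
have nX (i j : 'I_(6 + 6)%N) : x (Q12_enum i * (Q12_enum j)^-1) = F i j.
  have wG k : ((nth (false, 0%N) Q12_words k).2 < 6)%N.
    by do 12![case: k => [|k] //]; rewrite nth_default.
  rewrite Q12_eltV // /F /X /Q12_enum; congr (x (Q12_elt _)).
  by case: i j => [[|[|[|[|[|[|[|[|[|[|[|[|//]]]]]]]]]]]] ?]
                  [[|[|[|[|[|[|[|[|[|[|[|[|//]]]]]]]]]]]] ?].
have Einj : injective (fun i : 'I_(6 + 6)%N => Q12_enum i).
  have E (k : 'I_(6 + 6)%N) : Q12_enum k = nth 1 (map Q12_elt Q12_words) k.
    by rewrite (nth_map (false, 0%N)).
  move=> i j /eqP; rewrite !E nth_uniq ?Q12_enum_uniq ?size_map // => /eqP.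
  exact: val_inj.
have EG (i : 'I_(6 + 6)%N) : Q12_enum i \in G.
  by rewrite -defG groupM ?groupX //; apply: mem_gen; rewrite inE cycle_id ?orbT.
have -> : group_det G x = (\det (\matrix_(i < 6 + 6, j < 6 + 6) F i j))%R.
  rewrite (@group_det_enum _ _ _ _ (6 + 6) _ oG Einj EG).
  by congr (\det _)%R; apply/matrixP=> i j; rewrite !mxE nX.
rewrite matrix_block.
pose U := (\matrix_(i < 6, j < 6) F i j)%R; pose V := (\matrix_(i < 6, j < 6) F i (6 + j)%N)%R.
have -> : (\matrix_(i < 6, j < 6) F (6 + i)%N j)%R = V.
  by apply/matrixP=> -[[|[|[|[|[|[|//]]]]]] ?] [[|[|[|[|[|[|//]]]]]] ?]; rewrite !mxE.
have -> : (\matrix_(i < 6, j < 6) F (6 + i)%N (6 + j)%N)%R = U.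
  by apply/matrixP=> -[[|[|[|[|[|[|//]]]]]] ?] [[|[|[|[|[|[|//]]]]]] ?]; rewrite !mxE.
rewrite -/U -/V det_block_swap -!det_twisted_entry; congr (_ * _)%R; congr (\det _)%R.
  apply/matrixP=> -[[|[|[|[|[|[|//]]]]]] ?] [[|[|[|[|[|[|//]]]]]] ?]; rewrite !mxE;
    rewrite /F /twisted_entry /=; ring.
apply/matrixP=> -[[|[|[|[|[|[|//]]]]]] ?] [[|[|[|[|[|[|//]]]]]] ?]; rewrite !mxE;
  rewrite /F /twisted_entry /=; ring.
Qed.

Lemma int_group_dets_Q12 (n : int) :
  int_group_dets G n <-> Q12_value n.
Proof.
split=> [[x ->]|[u [v [p [q ->]]]]].
  by rewrite group_det_Q12; exists (fun i => x (Q12_enum i)); do 3!eexists; reflexivity.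
pose X := [:: u 0%N; u 1%N; u 2%N; v 0%N; v 1%N; v 2%N;
              p 0%N; p 1%N; p 2%N; q 0%N; q 1%N; q 2%N].
exists (fun g => nth 0%R X (index g (map Q12_elt Q12_words))).
rewrite group_det_Q12.
have E k : (k < 12)%N -> index (Q12_enum k) (map Q12_elt Q12_words) = k.
  move=> k12; have -> : Q12_enum k = nth 1 (map Q12_elt Q12_words) k.
    by rewrite (nth_map (false, 0%N)).
  by rewrite index_uniq ?size_map ?Q12_enum_uniq.
by rewrite /twisted_det /tsum /tnorm !E.
Qed.

End Q12.

Lemma int_parity (z : int) : exists t : int, z = 2 * t \/ z = 2 * t + 1.
Proof. exists (z %/ 2)%Z; lia. Qed.

Lemma int_mod3 (z : int) : exists t : int, [\/ z = 3 * t, z = 3 * t + 1 | z = 3 * t + 2].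
Proof.
exists (z %/ 3)%Z.
have : [|| z == 3 * (z %/ 3)%Z, z == 3 * (z %/ 3)%Z + 1 | z == 3 * (z %/ 3)%Z + 2] by lia.
by case/or3P=> /eqP; [constructor 1 | constructor 2 | constructor 3].
Qed.

Definition vint (p : nat) (x : int) := logn p `|x|.

Lemma vintM p (x y : int) : x != 0 -> y != 0 -> vint p (x * y) = (vint p x + vint p y)%N.
Proof. by move=> x0 y0; rewrite /vint abszM lognM ?absz_gt0. Qed.

Lemma leq_vint p (x : int) k : prime p -> x != 0 -> (k <= vint p x)%N = ((p ^ k)%N%:Z %| x)%Z.
Proof. by move=> pp x0; rewrite /vint dvdzE /= pfactor_dvdn ?absz_gt0. Qed.

Lemma vint_gt0 p (x : int) : prime p -> x != 0 -> (0 < vint p x)%N = (p%:Z %| x)%Z.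
Proof. by move=> pp x0; rewrite leq_vint // expn1. Qed.

Lemma decomp23 (n : int) : n != 0 ->
  exists2 m : int, coprimez m 6 & n = 2 ^+ vint 2 n * 3 ^+ vint 3 n * m.
Proof.
move=> n0; have n_gt0 : (0 < `|n|)%N by rewrite absz_gt0.
have [m1 co2 E1] := pfactor_coprime (isT : prime 2) n_gt0.
have m1_gt0 : (0 < m1)%N by case: m1 E1 {co2} n_gt0 => // ->.
have [m2 co3 E2] := pfactor_coprime (isT : prime 3) m1_gt0.
have v3 : logn 3 m1 = logn 3 `|n|.
  by rewrite E1 lognM ?expn_gt0 // lognX (_ : logn 3 2 = 0%N) // muln0 addn0.
exists (sgz n * m2%:Z).
  rewrite coprimezE abszM absz_sg n0 mul1n (coprimeMr _ 2 3).
  rewrite 2![coprime m2 _]coprime_sym co3 andbT.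
  by move: co2; rewrite E2 coprimeMr => /andP[].
rewrite /vint -v3 [LHS]intEsg mulrCA; congr (_ * _).
rewrite {1}E1 {1}E2 !PoszM -!natz !natrX; lia.
Qed.

Lemma mod3_eq1 n :
  (0 < n)%N -> (forall p, prime p -> (p %| n)%N -> p %% 3 = 1)%N -> (n %% 3 = 1)%N.
Proof.
elim/ltn_ind: n => n IHn n_gt0 h; have [n1|n1] := leqP n 1.
  by rewrite (anti_leq (_ : n <= 1 <= n)%N) ?n1.
have [p pp pn] := pdivP n1; have /dvdnP[m E] := pn.
have m_gt0 : (0 < m)%N by case: m E n_gt0 => // ->.
have mn : (m < n)%N by rewrite [ltnRHS]E ltn_Pmulr ?prime_gt1.
have m3 : (m %% 3 = 1)%N.
  by apply: (IHn m mn m_gt0) => q qq qm; apply: h => //; rewrite E dvdn_mulr.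
by rewrite E -modnMm m3 (h p pp pn).
Qed.

Lemma prime_mod3_eq2 n :
  (n %% 3 = 2)%N -> exists2 p, prime p & (p %| n)%N && (p %% 3 == 2)%N.
Proof.
move=> n3; have n_gt0 : (0 < n)%N by case: n n3.
have [i /and3P[h1 h2 h3]|h] := pickP (fun i : 'I_n.+1 => [&& prime i, i %| n & i %% 3 == 2]%N).
  by exists i => //; rewrite h2.
suff : (n %% 3 = 1)%N by rewrite n3.
apply: mod3_eq1 => // p pp pn; have pn1 : (p < n.+1)%N by rewrite ltnS dvdn_leq.
move: (h (Ordinal pn1)); rewrite /= pp pn /=; have : (p %% 3 != 0)%N.
  apply: contraL pn => /eqP p0; have /prime_nt_dvdP : (3 %| p)%N by rewrite /dvdn p0.
  by move=> /(_ pp isT) <-; rewrite /dvdn n3.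
lia.
Qed.

Lemma expf_pred_Fp p (z : 'F_p) : prime p -> z != 0 -> z ^+ p.-1 = 1.
Proof.
move=> pp z0; apply: (mulfI z0); rewrite -exprS prednK ?prime_gt0 // mulr1.
by rewrite -{2}(expf_card z) card_Fp.
Qed.

Lemma sum_squares_mod4 p (x y : int) : prime p -> (p %% 4 = 3)%N ->
  (p%:Z %| x ^+ 2 + y ^+ 2)%Z -> (p%:Z %| x)%Z /\ (p%:Z %| y)%Z.
Proof.
move=> pp p4; have Fp0 := pchar_Fp pp.
rewrite !(dvdz_pcharf Fp0) rmorphD !rmorphXn /=.
move: (x%:~R : 'F_p) (y%:~R : 'F_p) => {}x {}y; rewrite addr_eq0 => /eqP E.
have [y0|y0] := eqVneq y 0.
  by move/eqP: E; rewrite y0 expr0n oppr0 expf_eq0 /= => ->.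
have z2 : (x / y) ^+ 2 = -1 by rewrite expr_div_n E mulNr divff // expf_neq0.
have z0 : x / y != 0.
  by apply: contra_eq_neq z2 => ->; rewrite expr0n eq_sym oppr_eq0 oner_eq0.
have := expf_pred_Fp pp z0; have -> : p.-1 = (2 * (p %/ 4 * 2).+1)%N by lia.
rewrite exprM z2 exprS mulnC exprM sqrrN !expr1n mulr1 => /eqP.
rewrite eq_sym -addr_eq0 -(dvdn_pcharf Fp0 2) => /dvdn_leq; lia.
Qed.

Lemma vint_diff_squares (x y k l : int) (P := x ^+ 2 - y ^+ 2)
    (Q := (x + 2 * k) ^+ 2 + (y + 2 * l) ^+ 2) : P != 0 -> Q != 0 ->
  [\/ vint 2 P = 0%N /\ vint 2 Q = 0%N, (3 <= vint 2 P)%N /\ vint 2 Q = 1%N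
    | [/\ (2 <= vint 2 P)%N, vint 2 P != 3%N & (2 <= vint 2 Q)%N]].
Proof.
move=> P0 Q0.
have pr2 : prime 2 by [].
have p1 : (0 < vint 2 P)%N = (2 %| P)%Z by exact: (@leq_vint 2 P 1).
have p2 : (1 < vint 2 P)%N = (4 %| P)%Z by exact: (@leq_vint 2 P 2).
have p3 : (2 < vint 2 P)%N = (8 %| P)%Z by exact: (@leq_vint 2 P 3).
have p4 : (3 < vint 2 P)%N = (16 %| P)%Z by exact: (@leq_vint 2 P 4).
have q1 : (0 < vint 2 Q)%N = (2 %| Q)%Z by exact: (@leq_vint 2 Q 1).
have q2 : (1 < vint 2 Q)%N = (4 %| Q)%Z by exact: (@leq_vint 2 Q 2).
move: (vint 2 P) (vint 2 Q) p1 p2 p3 p4 q1 q2 => a b; rewrite /P /Q {P0 Q0 P Q}.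
have [i hi] := int_parity x; have [j hj] := int_parity y.
have [i' hi'] := int_parity i; have [j' hj'] := int_parity j.
case: hi => ->; case: hj => ->.
- have -> : (2 * i + 2 * k) ^+ 2 + (2 * j + 2 * l) ^+ 2
      = 4 * ((i + k) ^+ 2 + (j + l) ^+ 2) by ring.
  move=> p1 p2 p3 p4 q1 q2; constructor 3.
  suff [w [e [we e1]]] : exists w e : int,
      (2 * i) ^+ 2 - (2 * j) ^+ 2 = 16 * w + 4 * e /\ `|e| <= 1.
    rewrite p2 q2 we dvdz_mulr //.
    have e34 : (2 < a)%N = (3 < a)%N by rewrite p3 p4 we; clear -e1; lia.
    by split=> //; clear -e34; lia.
  case: hi' => ->; case: hj' => ->.
  + by exists (i' ^+ 2 - j' ^+ 2), 0; split; first ring.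
  + by exists (i' ^+ 2 - j' ^+ 2 - j'), (-1); split; first ring.
  + by exists (i' ^+ 2 - j' ^+ 2 + i'), 1; split; first ring.
  + by exists (i' ^+ 2 - j' ^+ 2 + i' - j'), 0; split; first ring.
- have -> : (2 * i) ^+ 2 - (2 * j + 1) ^+ 2 = 2 * (2 * (i ^+ 2 - j ^+ 2 - j) - 1) + 1 by ring.
  have -> : (2 * i + 2 * k) ^+ 2 + (2 * j + 1 + 2 * l) ^+ 2
      = 2 * (2 * ((i + k) ^+ 2 + (j + l) ^+ 2 + j + l)) + 1 by ring.
  by move: (_ - 1) (2 * (_ + l)) => v w p1 _ _ _ q1 _; constructor 1; clear -p1 q1; lia.
- have -> : (2 * i + 1) ^+ 2 - (2 * j) ^+ 2 = 2 * (2 * (i ^+ 2 - j ^+ 2 + i)) + 1 by ring.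
  have -> : (2 * i + 1 + 2 * k) ^+ 2 + (2 * j + 2 * l) ^+ 2
      = 2 * (2 * ((i + k) ^+ 2 + (j + l) ^+ 2 + i + k)) + 1 by ring.
  by move: (2 * (_ + i)) (2 * (_ + k)) => v w p1 _ _ _ q1 _; constructor 1; clear -p1 q1; lia.
have -> : (2 * i + 1 + 2 * k) ^+ 2 + (2 * j + 1 + 2 * l) ^+ 2
    = 4 * ((i + k) ^+ 2 + (j + l) ^+ 2 + i + k + j + l) + 2 by ring.
have [e e2] : exists e, i ^+ 2 + i - (j ^+ 2 + j) = 2 * e.
  case: hi' => ->; case: hj' => ->.
  - by exists (2 * i' ^+ 2 + i' - 2 * j' ^+ 2 - j'); ring.
  - by exists (2 * i' ^+ 2 + i' - 2 * j' ^+ 2 - 3 * j' - 1); ring.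
  - by exists (2 * i' ^+ 2 + 3 * i' + 1 - 2 * j' ^+ 2 - j'); ring.
  - by exists (2 * i' ^+ 2 + 3 * i' - 2 * j' ^+ 2 - 3 * j'); ring.
have -> : (2 * i + 1) ^+ 2 - (2 * j + 1) ^+ 2 = 4 * (i ^+ 2 + i - (j ^+ 2 + j)) by ring.
rewrite e2; move: (_ + l) => w _ _ p3 _ q1 q2; constructor 2; split.
  by rewrite p3; clear; lia.
have {}q1 : (0 < b)%N by rewrite q1; clear; lia.
have {}q2 : ~~ (1 < b)%N by rewrite q2; clear; lia.
by clear -q1 q2; lia.
Qed.

Lemma vint3_sum_squares (s t : int) (Q := s ^+ 2 + t ^+ 2) : Q != 0 ->
  [/\ vint 3 Q != 1%N & vint 3 Q != 3%N].
Proof.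
move=> Q0; have pr3 : prime 3 by [].
have q1 : (0 < vint 3 Q)%N = (3 %| Q)%Z by exact: (@leq_vint 3 Q 1).
have q2 : (1 < vint 3 Q)%N = (9 %| Q)%Z by exact: (@leq_vint 3 Q 2).
have q3 : (2 < vint 3 Q)%N = (27 %| Q)%Z by exact: (@leq_vint 3 Q 3).
have q4 : (3 < vint 3 Q)%N = (81 %| Q)%Z by exact: (@leq_vint 3 Q 4).
have [Q3|Q3] := boolP (3 %| Q)%Z; last by rewrite -q1 in Q3; split; clear -Q3; lia.
have [/dvdzP[s' s3] /dvdzP[t' t3]] := @sum_squares_mod4 3 s t pr3 erefl Q3.
have QE : Q = 9 * (s' ^+ 2 + t' ^+ 2) by rewrite /Q s3 t3; ring.
have {}q2 : (1 < vint 3 Q)%N by rewrite q2 QE dvdz_mulr.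
have [h|h] := boolP (3 %| s' ^+ 2 + t' ^+ 2)%Z; last first.
  have {}q3 : ~~ (2 < vint 3 Q)%N by rewrite q3 QE; move: h; move: (_ + _) => w; clear; lia.
  by split; clear -q2 q3; lia.
have [/dvdzP[s2 s2E] /dvdzP[t2 t2E]] := @sum_squares_mod4 3 s' t' pr3 erefl h.
have {}q4 : (3 < vint 3 Q)%N.
  by rewrite q4 QE s2E t2E (_ : _ * _ = 81 * (s2 ^+ 2 + t2 ^+ 2)) ?dvdz_mulr //; ring.
by split; clear -q4; lia.
Qed.

Lemma Q12_prime_factor (s t c : int) (Q := s ^+ 2 + t ^+ 2) (B := Q - 3 * c) :
  Q != 0 -> 0 <= B -> odd (vint 2 Q) -> ~~ (3 %| Q)%Z -> ~~ (2 %| B)%Z ->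
  exists2 p, prime p &
    (p %% 12 = 5)%N /\ (p%:Z %| Q)%Z \/ (p %% 6 = 5)%N /\ ((p ^ 2)%N%:Z %| Q * B ^+ 2)%Z.
Proof.
move=> Q0 B0 oddQ Q3 B2.
have Q_ge0 : 0 <= Q by rewrite addr_ge0 ?sqr_ge0.
have Q_gt0 : (0 < `|Q|)%N by rewrite absz_gt0.
have [m co2 E] := pfactor_coprime (isT : prime 2) Q_gt0.
have m_odd : odd m by rewrite -coprime2n.
have m3 : (m %% 3 != 0)%N.
  by apply: contra Q3 => m3; rewrite dvdzE /= E dvdn_mulr.
have odd_mod6 q : odd q -> (q %% 3 = 2)%N -> (q %% 6 = 5)%N by clear; lia.
have [m2|m1] : (m %% 3 = 2)%N \/ (m %% 3 = 1)%N by clear -m3; lia.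
  have [p pp /andP[pm /eqP p3]] := prime_mod3_eq2 m2.
  have p_odd : odd p by apply: dvdn_odd pm m_odd.
  have pQ : (p%:Z %| Q)%Z by rewrite dvdzE /= E dvdn_mulr.
  exists p => //; have [p5|p11] : (p %% 12 = 5)%N \/ (p %% 12 = 11)%N by clear -p_odd p3; lia.
    by left.
  have p4 : (p %% 4 = 3)%N by clear -p11; lia.
  right; split; first exact: odd_mod6.
  have [/dvdzP[s' s'E] /dvdzP[t' t'E]] := sum_squares_mod4 pp p4 pQ.
  have QE : Q = (s' ^+ 2 + t' ^+ 2) * p%:Z ^+ 2 by rewrite /Q s'E t'E; ring.
  rewrite dvdz_mulr // QE.
  by rewrite (_ : Posz (p ^ 2) = p%:Z ^+ 2) // dvdz_mull ?dvdzz.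
have B3 : (`|B| %% 3 = 2)%N.
  have [j jE] : exists j, vint 2 Q = j.*2.+1 by exists (vint 2 Q)./2; clear -oddQ; lia.
  have : (`|Q| %% 3 = 2)%N.
    have e2 : (2 ^ j.*2.+1 %% 3 = 2)%N by rewrite expnS -mul2n expnM -modnMmr -modnXm exp1n.
    by rewrite E -/(vint 2 Q) jE -modnMm m1 e2.
  by move: B0; rewrite /B; clear -Q_ge0; move: Q Q_ge0 => q; lia.
have [p pp /andP[pB /eqP p3]] := prime_mod3_eq2 B3.
exists p => //; right; split.
  apply: odd_mod6 => //; rewrite -coprime2n prime_coprime //; apply: contra B2 => p2.
  by rewrite dvdzE; apply: dvdn_trans pB.
by rewrite dvdz_mull // dvdzE abszX dvdn_exp2r.
Qed.

Lemma coprimez_factor (m : int) (k : nat) : coprimez m 6 -> (k%:Z %| m)%Z ->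
  exists2 m', coprimez m' 6 & m = m' * k%:Z.
Proof.
move=> co /dvdzP[m' E]; exists m' => //.
by move: co; rewrite E coprimezMl => /andP[].
Qed.

Lemma dvdz_23 (m : int) (k a b : nat) : coprime k 6 ->
  (k%:Z %| 2 ^+ a * 3 ^+ b * m)%Z = (k%:Z %| m)%Z.
Proof.
rewrite (coprimeMr _ 2 3) => /andP[k2 k3].
by rewrite -mulrA !Gauss_dvdzr // coprimezE abszX coprimeXr.
Qed.

Lemma Q12_det_forms (x y k l c d : int) (P := x ^+ 2 - y ^+ 2)
    (Q := (x + 2 * k) ^+ 2 + (y + 2 * l) ^+ 2) (A := P - 3 * c) (B := Q - 3 * d)
    (n := P * A ^+ 2 * (Q * B ^+ 2)) :
  0 <= B -> (2 %| A - B)%Z -> n = 0 \/ [\/ form_i n, form_ii n | form_iii n].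
Proof.
move=> B0 AB; have [|n0] := eqVneq n 0; [by left | right].
have [P0 A0 Q0 Bn0] : [/\ P != 0, A != 0, Q != 0 & B != 0].
  by move: n0; rewrite /n !mulf_eq0 !negb_or -!andbA => /and5P[-> -> _ -> /andP[->]].
have vn p : vint p n = (vint p P + 2 * vint p A + (vint p Q + 2 * vint p B))%N.
  by rewrite /n !vintM ?mulf_neq0 // !mul2n -!addnn.
have [pr2 pr3] : prime 2 /\ prime 3 by [].
have dvdB z w : (3 %| z - 3 * w)%Z = (3 %| z)%Z by clear; lia.
have v2AB : (0 < vint 2 A)%N = (0 < vint 2 B)%N.
  by rewrite !vint_gt0 //; move: AB; clear; lia.
have v3PA : (0 < vint 3 P)%N = (0 < vint 3 A)%N by rewrite !vint_gt0 // dvdB.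
have v3QB : (0 < vint 3 Q)%N = (0 < vint 3 B)%N by rewrite !vint_gt0 // dvdB.
have v2 := vint_diff_squares P0 Q0; have v3 := vint3_sum_squares Q0.
have [m co nE] := decomp23 n0.
have b03 : vint 3 n = 0%N \/ (3 <= vint 3 n)%N.
  rewrite vn; move: (vint 3 P) (vint 3 A) (vint 3 Q) (vint 3 B) v3PA v3QB v3 => p a q b.
  by clear => ? ? []; lia.
have a04 : [|| vint 2 n == 0, vint 2 n == 4, 6 <= vint 2 n
              | (vint 2 n == 5) && odd (vint 2 Q) && (vint 2 B == 0)]%N.
  rewrite vn; move: (vint 2 P) (vint 2 A) (vint 2 Q) (vint 2 B) v2 v2AB => p a q b.
  by clear; case=> [[]|[]|[]] *; lia.
case/or4P: a04 => [/eqP a0|/eqP a4|a6|/andP[/andP[/eqP a5 oddQ] /eqP B2]].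
1-3: constructor 1; exists (vint 2 n), (vint 3 n), m; split=> //.
- by constructor 1.
- by constructor 2.
- by constructor 3.
rewrite a5 in nE; have [Q3|Q3] := boolP (3 %| Q)%Z.
  constructor 2; exists (vint 3 n), m; split=> //.
  move: Q3; rewrite -(@vint_gt0 3) // vn.
  move: (vint 3 P) (vint 3 A) (vint 3 Q) (vint 3 B) v3PA v3QB v3 => p a q b.
  by clear => ? ? []; lia.
have [|p pp h] := Q12_prime_factor Q0 B0 oddQ Q3.
  by rewrite -(@vint_gt0 2) // B2.
have {h} [j jE [jn j6]] : exists2 j : nat,
      j = p /\ p = 5 %[mod 12] \/ j = (p ^ 2)%N /\ p = 5 %[mod 6]
    & (j%:Z %| n)%Z /\ coprime j 6.
  case: h => [[p5 pQ]|[p5 pQ]].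
    exists p; [by left | split; first by rewrite dvdz_mull // dvdz_mulr].
    by have p6 : (p %% 6 = 5)%N by [clear -p5; lia]; rewrite -coprime_modl p6.
  exists (p ^ 2)%N; [by right | split; first by rewrite dvdz_mull].
  by rewrite coprimeXl // -coprime_modl p5.
rewrite nE dvdz_23 // in jn; have [m' co' mE] := coprimez_factor co jn.
have : [|| vint 3 n == 0, vint 3 n == 3, vint 3 n == 5 | (vint 3 n == 4) || (6 <= vint 3 n)]%N.
  by move: b03; clear; lia.
case/or4P=> [/eqP b0|/eqP b3|/eqP b5|b6].
1-3: constructor 3; exists (vint 3 n), p, j, m'; split=> //; last by rewrite [LHS]nE mE mulrA.
- by constructor 1.
- by constructor 2.
- by constructor 3.
by constructor 2; exists (vint 3 n), m; split=> //; case/orP: b6 => [/eqP|]; [left | right].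
Qed.

Lemma sqr_le_norm (x m : int) : `|x| <= m -> x ^+ 2 <= m ^+ 2.
Proof.
move=> xm; rewrite -(real_normK (num_real x)) lerXn2r ?nnegrE //.
exact: le_trans xm.
Qed.

Lemma balanced_mod (m : nat) (z c : int) : (0 < m)%N ->
  exists q : int, `|2 * (z - q * m%:Z) - c| <= m%:Z.
Proof.
move=> m0; exists ((2 * z - c + m%:Z) %/ (2 * m%:Z))%Z.
have h := divz_eq (2 * z - c + m%:Z) (2 * m%:Z).
have h1 : 0 <= ((2 * z - c + m%:Z) %% (2 * m%:Z))%Z by rewrite modz_ge0 //; lia.
have h2 : ((2 * z - c + m%:Z) %% (2 * m%:Z))%Z < 2 * m%:Z by rewrite ltz_pmod //; lia.
move: (_ %/ _)%Z (_ %% _)%Z h h1 h2 => q r h h1 h2.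
have -> : 2 * (z - q * m%:Z) - c = r - m%:Z.
  by rewrite -[r](addKr (q * (2 * m%:Z))) -h; ring.
clear -h1 h2; lia.
Qed.

Lemma prime_descent (S : int -> Prop) (p : nat) : prime p ->
  (exists m : nat, (0 < m < p)%N /\ S (m%:Z * p%:Z)) ->
  (forall m : nat, (1 < m < p)%N -> S (m%:Z * p%:Z) ->
     exists r : int, 0 <= r < m%:Z /\ (r = 0 -> (m %| p)%N) /\ S (r * p%:Z)) ->
  S p%:Z.
Proof.
move=> pp [m0 [m0p Sm0]] step.
elim/ltn_ind: m0 m0p Sm0 => m IHm /andP[m_gt0 mp] Sm.
have [m1|m1] := leqP m 1.
  by move: Sm; rewrite (_ : m = 1%N) ?mul1r //; clear -m_gt0 m1; lia.
have [|r [/andP[r_ge0 rm] [r0 Sr]]] := step m _ Sm; first by rewrite m1.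
have rE : r = `|r|%N by rewrite gez0_abs.
apply: (IHm `|r|%N); last by rewrite -rE.
  by clear -rE rm; lia.
apply/andP; split; last by clear -rE rm mp; lia.
rewrite absz_gt0; apply: contraTneq m1 => /r0 mdiv; rewrite -leqNgt.
have := primeP pp => -[_ /(_ _ mdiv)]; clear -mp; lia.
Qed.

Lemma two_squares_descent (p : nat) (z : int) : prime p -> (p%:Z %| z ^+ 2 + 1)%Z ->
  exists x y : int, p%:Z = x ^+ 2 + y ^+ 2.
Proof.
move=> pp pz; have p1 := prime_gt1 pp.
apply: (@prime_descent (fun n => exists x y : int, n = x ^+ 2 + y ^+ 2) p pp).
  have [q hq] := balanced_mod z 0 (prime_gt0 pp); set w := z - _ in hq.
  have /dvdzP[m mE] : (p%:Z %| w ^+ 2 + 1)%Z.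
    have -> : w ^+ 2 + 1 = z ^+ 2 + 1 + p%:Z * (- (2 * q * z) + q ^+ 2 * p%:Z).
      by rewrite /w; ring.
    by rewrite rpredD // dvdz_mulr.
  exists `|m|%N.
  have w2 : 4 * w ^+ 2 <= p%:Z ^+ 2.
    by rewrite (_ : 4 * w ^+ 2 = (2 * w - 0) ^+ 2); [exact: sqr_le_norm | ring].
  have m_gt0 : 0 < m by have := sqr_ge0 w; clear -mE p1; nia.
  rewrite gtz0_abs //; split; last by exists w, 1; rewrite -mE; ring.
  by clear -m_gt0 mE w2 p1; nia.
move=> m /andP[m1 mp] [x [y xyE]].
have m_gt0 : (0 < m)%N by clear -m1; lia.
have [q hq] := balanced_mod x 0 m_gt0; have [r hr] := balanced_mod y 0 m_gt0.
pose x' := x - q * m%:Z; pose y' := y - r * m%:Z.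
pose n := p%:Z - 2 * (q * x + r * y) + m%:Z * (q ^+ 2 + r ^+ 2).
have nE : m%:Z * n = x' ^+ 2 + y' ^+ 2 by rewrite /n /x' /y' !mulrDr xyE; ring.
have x2 : 4 * x' ^+ 2 <= m%:Z ^+ 2.
  by rewrite (_ : 4 * x' ^+ 2 = (2 * x' - 0) ^+ 2); [exact: sqr_le_norm | ring].
have y2 : 4 * y' ^+ 2 <= m%:Z ^+ 2.
  by rewrite (_ : 4 * y' ^+ 2 = (2 * y' - 0) ^+ 2); [exact: sqr_le_norm | ring].
exists n; split.
  have := sqr_ge0 x'; have := sqr_ge0 y'; clear -nE x2 y2 m_gt0; nia.
split.
  move=> n0; have [x0 y0] : x' = 0 /\ y' = 0.
    have := sqr_ge0 x'; have := sqr_ge0 y'; rewrite n0 mulr0 in nE => h1 h2.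
    by split; apply/eqP; rewrite -sqrf_eq0; apply/eqP; clear -nE h1 h2; lia.
  have {}x0 : x = q * m%:Z by apply/eqP; rewrite -subr_eq0 -/x' x0.
  have {}y0 : y = r * m%:Z by apply/eqP; rewrite -subr_eq0 -/y' y0.
  have pE : p%:Z = m%:Z * (q ^+ 2 + r ^+ 2).
    by apply: (@mulfI _ m%:Z); [lia | rewrite xyE x0 y0; ring].
  by have : (m%:Z %| p%:Z)%Z by rewrite pE dvdz_mulr.
exists (p%:Z - q * x - r * y), (q * y - r * x).
apply: (@mulfI _ (m%:Z ^+ 2)); first by rewrite expf_neq0 //; lia.
have -> : m%:Z ^+ 2 * (n * p%:Z) = (m%:Z * n) * (m%:Z * p%:Z) by ring.
have -> : m%:Z ^+ 2 * ((p%:Z - q * x - r * y) ^+ 2 + (q * y - r * x) ^+ 2)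
  = (m%:Z * p%:Z - m%:Z * (q * x + r * y)) ^+ 2 + (m%:Z * (q * y - r * x)) ^+ 2 by ring.
rewrite nE xyE /x' /y'; ring.
Qed.

Definition eisnorm (a b : int) : int := a ^+ 2 - a * b + b ^+ 2.

Lemma eisnorm_ge0 a b : 0 <= eisnorm a b.
Proof.
rewrite -(@pmulr_rge0 _ 4) // (_ : 4 * _ = (2 * a - b) ^+ 2 + 3 * b ^+ 2); last first.
  by rewrite /eisnorm; ring.
by rewrite addr_ge0 ?sqr_ge0 // mulr_ge0 ?sqr_ge0.
Qed.

Lemma eisnorm_eq0 a b : eisnorm a b = 0 -> a = 0 /\ b = 0.
Proof.
rewrite /eisnorm => h; have hb : b = 0.
  apply/eqP; rewrite -sqrf_eq0; apply/eqP.
  by have := sqr_ge0 (2 * a - b); have := sqr_ge0 b; nia.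
by split=> //; move: h; rewrite hb; nia.
Qed.

Lemma eisnorm_reduce (m : nat) (a b : int) : (0 < m)%N ->
  exists r s : int, 16 * eisnorm (a - r * m%:Z) (b - s * m%:Z) <= 7 * m%:Z ^+ 2.
Proof.
move=> m0; have [s hs] := balanced_mod b 0 m0.
have [r hr] := balanced_mod a (b - s * m%:Z) m0; exists r, s.
move: (a - _) (b - _) hs hr => {}a {}b; rewrite subr0 => hs hr.
have b2 : (2 * b) ^+ 2 <= m%:Z ^+ 2 by exact: sqr_le_norm.
have a2 : (2 * a - b) ^+ 2 <= m%:Z ^+ 2 by exact: sqr_le_norm.
rewrite (_ : 16 * _ = 4 * (2 * a - b) ^+ 2 + 3 * (2 * b) ^+ 2); last by rewrite /eisnorm; ring.
by clear -a2 b2; lia.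
Qed.

Lemma two_eisnorm_descent (p : nat) (z w : int) :
  prime p -> odd p -> (p%:Z %| z ^+ 2 + 3 * w ^+ 2 + 1)%Z ->
  exists a b c d : int, p%:Z = eisnorm a b + eisnorm c d.
Proof.
move=> pp p_odd pz; have p1 := prime_gt1 pp.
apply: (@prime_descent (fun n => exists a b c d : int, n = eisnorm a b + eisnorm c d) p pp).
  have [q hq] := balanced_mod z 0 (prime_gt0 pp); have [r hr] := balanced_mod w 0 (prime_gt0 pp).
  set z' := z - _ in hq; set w' := w - _ in hr.
  have /dvdzP[m mE] : (p%:Z %| z' ^+ 2 + 3 * w' ^+ 2 + 1)%Z.
    have -> : z' ^+ 2 + 3 * w' ^+ 2 + 1 = z ^+ 2 + 3 * w ^+ 2 + 1
        + p%:Z * (- (2 * q * z) + q ^+ 2 * p%:Z + 3 * (- (2 * r * w) + r ^+ 2 * p%:Z)).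
      by rewrite /z' /w'; ring.
    by rewrite rpredD // dvdz_mulr.
  exists `|m|%N.
  have z2 : (2 * z') ^+ 2 <= (p%:Z - 1) ^+ 2.
    by apply: sqr_le_norm; clear -p_odd p1 hq; lia.
  have w2 : (2 * w') ^+ 2 <= (p%:Z - 1) ^+ 2.
    by apply: sqr_le_norm; clear -p_odd p1 hr; lia.
  have m_gt0 : 0 < m by have := sqr_ge0 z'; have := sqr_ge0 w'; clear -mE p1; nia.
  rewrite gtz0_abs //; split; last first.
    by exists (z' + w'), (2 * w'), 1, 0; rewrite -mE /eisnorm; ring.
  by clear -m_gt0 mE z2 w2 p1; nia.
move=> m /andP[m1 mp] [a [b [c [d E]]]].
have m_gt0 : (0 < m)%N by clear -m1; lia.
have [r [s hrs]] := eisnorm_reduce a b m_gt0; have [t [u htu]] := eisnorm_reduce c d m_gt0.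
pose n := p%:Z - (2 * a * r - a * s - b * r + 2 * b * s)
  - (2 * c * t - c * u - d * t + 2 * d * u) + m%:Z * (eisnorm r s + eisnorm t u).
have nE : m%:Z * n = eisnorm (a - r * m%:Z) (b - s * m%:Z)
                     + eisnorm (c - t * m%:Z) (d - u * m%:Z).
  by rewrite /n !(mulrDr, mulrBr) E /eisnorm; ring.
have ge0_ab := eisnorm_ge0 (a - r * m%:Z) (b - s * m%:Z).
have ge0_cd := eisnorm_ge0 (c - t * m%:Z) (d - u * m%:Z).
exists n; split.
  have := ge0_ab; have := ge0_cd.
  move: (eisnorm _ _) (eisnorm _ _) nE hrs htu => e1 e2; clear -m_gt0; nia.
split.
  move=> n0; have [] : eisnorm (a - r * m%:Z) (b - s * m%:Z) = 0
                       /\ eisnorm (c - t * m%:Z) (d - u * m%:Z) = 0.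
    have := ge0_ab; have := ge0_cd.
    by move: nE; rewrite n0 mulr0; move: (eisnorm _ _) (eisnorm _ _) => e1 e2; clear; lia.
  move=> /eisnorm_eq0[/subr0_eq a0 /subr0_eq b0] /eisnorm_eq0[/subr0_eq c0 /subr0_eq d0].
  have pE : p%:Z = m%:Z * (eisnorm r s + eisnorm t u).
    by apply: (@mulfI _ m%:Z); [lia | rewrite E a0 b0 c0 d0 /eisnorm; ring].
  by have : (m%:Z %| p%:Z)%Z by rewrite pE dvdz_mulr.
(* In the quaternion order Z[w] + Z[w]j with j^2 = -1: the product of
   (a + b w) + (c + d w) j with the conjugate of its residue mod m, divided by m. *)
pose X0 := a * r - a * s + b * s + (c * t - c * u + d * u).
pose Y := a * s - b * r + (c * u - d * t).
pose Z := a * t - b * u - (c * r - d * s).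
pose W := a * u + b * t - b * u - (c * s + d * r - d * s).
exists (p%:Z - X0), Y, Z, W.
apply: (@mulfI _ (m%:Z ^+ 2)); first by rewrite expf_neq0 //; lia.
have -> : m%:Z ^+ 2 * (n * p%:Z) = (m%:Z * n) * (m%:Z * p%:Z) by ring.
have -> : m%:Z ^+ 2 * (eisnorm (p%:Z - X0) Y + eisnorm Z W)
  = eisnorm (m%:Z * p%:Z - m%:Z * X0) (m%:Z * Y) + eisnorm (m%:Z * Z) (m%:Z * W).
  by rewrite /eisnorm; ring.
rewrite nE E /X0 /Y /Z /W /eisnorm; ring.
Qed.

Lemma sub_opp_fibre_card (p : nat) (f : 'F_p -> 'F_p) : prime p ->
  (forall x y, f x = f y -> y = x \/ y = - x) -> (p <= #|f @: setT| * 2)%N.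
Proof.
move=> pp fP; rewrite -[leqLHS](card_Fp pp) -cardsT -sum1_card (partition_big_imset f) /=.
rewrite -sum_nat_const; apply: leq_sum => y /imsetP[x _ ->].
rewrite sum1dep_card (leq_trans (subset_leq_card (_ : _ \subset [set x; - x]))) ?cards2 //.
  by apply/subsetP=> z; rewrite !inE => /eqP/esym/fP[] ->; rewrite eqxx ?orbT.
by case: (_ != _).
Qed.

Lemma exists_sq_3sq (p : nat) : prime p -> (3 < p)%N ->
  exists z w : int, (p%:Z %| z ^+ 2 + 3 * w ^+ 2 + 1)%Z.
Proof.
move=> pp p3; have Fp0 := pchar_Fp pp.
have n3 : 3%:R != 0 :> 'F_p by rewrite -(dvdn_pcharf Fp0); apply/negP => /dvdn_leq; lia.
have odd_p : odd p by case: (even_prime pp) => // p2; move: p3; rewrite p2.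
have [z [w zw]] : exists z w : 'F_p, z ^+ 2 + 3%:R * w ^+ 2 + 1 = 0.
  pose f (x : 'F_p) := x ^+ 2; pose g (y : 'F_p) := - (3%:R * y ^+ 2 + 1).
  have cf : (p <= #|f @: setT| * 2)%N.
    apply: sub_opp_fibre_card => // x y /esym/eqP.
    by rewrite eqf_sqr => /orP[]/eqP; [left | right].
  have cg : (p <= #|g @: setT| * 2)%N.
    apply: sub_opp_fibre_card => // x y /oppr_inj/addIr/(mulfI n3)/esym/eqP.
    by rewrite eqf_sqr => /orP[]/eqP; [left | right].
  have : ~~ [disjoint f @: setT & g @: setT].
    apply/negP=> dis; have := max_card (mem (f @: setT :|: g @: setT)).
    rewrite cardsU disjoint_setI0 // cards0 subn0 card_Fp //.
    by move: odd_p cf cg; move: #|f @: _| #|g @: _| => A B; clear; lia.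
  case/pred0Pn=> t /andP[/imsetP[x _ ->] /imsetP[y _ E]].
  exists x, y; rewrite -addrA; move: E; rewrite /f /g => ->; exact: addNr.
exists (z : nat)%:Z, (w : nat)%:Z; rewrite (dvdz_pcharf Fp0).
rewrite !rmorphD rmorphM !rmorphXn /= -!pmulrn. rewrite !natr_Zp.
by rewrite -[X in _ == X]zw.
Qed.

Lemma exists_sqrtN1 (p : nat) : prime p -> (p %% 4 = 1)%N ->
  exists z : int, (p%:Z %| z ^+ 2 + 1)%Z.
Proof.
move=> pp p4; have Fp0 := pchar_Fp pp.
have [x x0 xn] : exists2 x : 'F_p, x != 0 & x ^+ (p %/ 4 * 2) != 1.
  apply/exists_inP; apply: contraT; rewrite negb_exists_in => /forall_inP h.
  pose q : {poly 'F_p} := 'X^(p %/ 4 * 2) - 1.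
  have sq : size q = (p %/ 4 * 2).+1 by rewrite size_XnsubC //; have := prime_gt1 pp; lia.
  have : (size (enum [set~ (0%R : 'F_p)]) < size q)%N.
    apply: max_poly_roots; rewrite ?enum_uniq // -?size_poly_eq0 ?sq //.
    apply/allP=> y; rewrite mem_enum !inE => /h.
    by rewrite negbK rootE !hornerE => /eqP->; rewrite subrr.
  by rewrite -cardE cardsC1 card_Fp // sq; have := prime_gt1 pp; clear -p4; lia.
have E : (x ^+ (p %/ 4)) ^+ 2 = -1.
  have := expf_pred_Fp pp x0; have -> : p.-1 = (p %/ 4 * 2 * 2)%N by lia.
  by rewrite exprM => /eqP; rewrite sqrf_eq1 (negPf xn) /= exprM => /eqP.
exists (x ^+ (p %/ 4) : nat)%:Z; rewrite (dvdz_pcharf Fp0) rmorphD rmorphXn /= -!pmulrn natr_Zp E.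
by rewrite addNr.
Qed.

Definition tpair (u : nat -> int) : int := u 0%N * u 1%N + u 0%N * u 2%N + u 1%N * u 2%N.

Lemma tnormE u : tnorm u = tsum u ^+ 2 - 3 * tpair u.
Proof. by rewrite /tnorm /tsum /tpair; ring. Qed.

Lemma tnorm_ge0 (u : nat -> int) : 0 <= tnorm u.
Proof.
have E : 2 * tnorm u = (u 0%N - u 1%N) ^+ 2 + (u 0%N - u 2%N) ^+ 2 + (u 1%N - u 2%N) ^+ 2.
  by rewrite /tnorm; ring.
by rewrite -(@pmulr_rge0 _ 2) // E !addr_ge0 ?sqr_ge0.
Qed.

Lemma Q12_value_forms n : Q12_value n -> n = 0 \/ [\/ form_i n, form_ii n | form_iii n].
Proof.
case=> u [v [p [q ->]]].
set up := fun i => u i + p i; set vp := fun i => v i + q i.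
set um := fun i => u i - p i; set vm := fun i => v i - q i.
have umE : tsum up + 2 * - tsum p = tsum um by rewrite /tsum /um /up; ring.
have vmE : tsum vp + 2 * - tsum q = tsum vm by rewrite /tsum /vm /vp; ring.
have := @Q12_det_forms (tsum up) (tsum vp) (- tsum p) (- tsum q)
  (tpair up - tpair vp) (tpair um + tpair vm).
rewrite /= umE vmE.
have -> : tsum up ^+ 2 - tsum vp ^+ 2 - 3 * (tpair up - tpair vp) = tnorm up - tnorm vp.
  by rewrite !tnormE; ring.
have -> : tsum um ^+ 2 + tsum vm ^+ 2 - 3 * (tpair um + tpair vm) = tnorm um + tnorm vm.
  by rewrite !tnormE; ring.
rewrite /twisted_det !mul1r !mulN1r !opprK; apply.
  by rewrite addr_ge0 ?tnorm_ge0.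
apply/dvdzP; exists (2 * (u 0%N * p 0%N + u 1%N * p 1%N + u 2%N * p 2%N)
  - (u 0%N * p 1%N + u 1%N * p 0%N + u 0%N * p 2%N + u 2%N * p 0%N
     + u 1%N * p 2%N + u 2%N * p 1%N)
  - tnorm v - tnorm q).
by rewrite /tnorm /up /vp /um /vm; ring.
Qed.

Lemma Q12_value_seq (u v p q : seq int) (n : int) :
  n = twisted_det 1 (fun i => u`_i + p`_i) (fun i => v`_i + q`_i)
      * twisted_det (-1) (fun i => u`_i - p`_i) (fun i => v`_i - q`_i) -> Q12_value n.
Proof. by move=> ->; exists (nth 0 u), (nth 0 v), (nth 0 p), (nth 0 q). Qed.

Ltac Q12_witness u v p q :=
  apply: (@Q12_value_seq u v p q); rewrite /twisted_det /tsum /tnorm /=; ring.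

Lemma coprimez_6 (m : int) : coprimez m 6 -> ~~ (2 %| m)%Z /\ ~~ (3 %| m)%Z.
Proof.
rewrite coprimezE (coprimeMr _ 2 3) ![coprime `|m| _]coprime_sym !prime_coprime //.
by case/andP; rewrite !dvdzE.
Qed.

Lemma Q12_value_1mod12 (t : int) : Q12_value (12 * t + 1).
Proof. Q12_witness [:: 1 + t; t; t] [:: t; t; t] [:: t; t; t] [:: t; t; t]. Qed.

Lemma Q12_value_5mod12 (t : int) : Q12_value (12 * t + 5).
Proof. Q12_witness [:: 1 + t; 1 + t; t] [:: 1 + t; t; t] [:: t; 1 + t; t] [:: 1 + t; t; t]. Qed.

Lemma Q12_value_32p (p : nat) : prime p -> (p %% 12 = 5)%N -> Q12_value (2 ^+ 5 * p%:Z).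
Proof.
move=> pp p5; have [|z pz] := exists_sqrtN1 pp; first by clear -p5; lia.
have [c [d pE]] := two_squares_descent pp pz.
have mod3 (s t : int) : p%:Z = s ^+ 2 + t ^+ 2 -> exists e, s ^+ 2 = (3 * e + 2) ^+ 2.
  move=> E; have [e [se|se|se]] := int_mod3 s.
  - have [f ft] := int_mod3 t; rewrite se in E; exfalso.
    by case: ft => ft; rewrite ft in E; clear -p5 E; lia.
  - by exists (- e - 1); rewrite se; ring.
  - by exists e; rewrite se.
have [e ce] := mod3 _ _ pE; have [f df] := mod3 d c (etrans pE (addrC _ _)).
rewrite ce df in pE.
have [j ej] := int_parity (e - f).
have {ej}ej : e - f = 2 * j + 1.
  case: ej => // ej; exfalso; have {}ej : e = 2 * j + f by rewrite -ej subrK.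
  by rewrite ej in pE; clear -p5 pE; lia.
have {}ej : e = f + 2 * j + 1 by rewrite -addrA -ej addrC subrK.
pose k := f + j + 1.
rewrite pE ej (_ : _ * _ = 2 ^+ 4 * ((6 * k + 1) ^+ 2 + (6 * j + 3) ^+ 2)); last first.
  by rewrite /k; ring.
(* The sums of the triples are 5, 3, 6k + 1 and 6j + 3, their norms 1, 0, 1 and 0. *)
Q12_witness [:: 1 + k; 1 + k; 1 + k] [:: 1 + j; 1 + j; 1 + j]
            [:: 1 - k; 1 - k; - k] [:: - j; - j; - j].
Qed.

Lemma eisnorm_triple (a b : int) : ~~ (3 %| eisnorm a b)%Z -> exists x y z : int,
  [/\ x + y + (2 * z + 1) = 1,
      eisnorm a b = x ^+ 2 + y ^+ 2 + (2 * z + 1) ^+ 2 - x * y - x * (2 * z + 1) - y * (2 * z + 1)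
    & exists x' y', x = 2 * x' /\ y = 2 * y' \/ x = 2 * x' + 1 /\ y = 2 * y' + 1].
Proof.
move=> n3.
have [x [y [z [s N]]]] : exists x y z : int, x + y + z = 1
    /\ eisnorm a b = x ^+ 2 + y ^+ 2 + z ^+ 2 - x * y - x * z - y * z.
  have [t [E|E|E]] := int_mod3 (a + b).
  - case/negP: n3; rewrite (_ : eisnorm a b = 3 * (3 * t ^+ 2 - a * b)) ?dvdz_mulr //.
    rewrite (_ : eisnorm a b = (a + b) ^+ 2 - 3 * (a * b)); last by rewrite /eisnorm; ring.
    by rewrite E; ring.
  - exists (a - t), (b - t), (- t); split; last by rewrite /eisnorm; ring.
    by rewrite (_ : _ + _ = a + b - 3 * t); [rewrite E; ring | ring].
  exists (- a + t + 1), (- b + t + 1), (t + 1); split; last by rewrite /eisnorm; ring.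
  by rewrite (_ : _ + _ = 3 * t + 3 - (a + b)); [rewrite E; ring | ring].
have [x' hx] := int_parity x; have [y' hy] := int_parity y; have [z' hz] := int_parity z.
case: hz => hz; last first.
  exists x, y, z'; rewrite -hz; split=> //; exists x', y'.
  case: hx => hx; case: hy => hy; [by left | | | by right]; exfalso; clear -s hx hy hz; lia.
case: hy => hy.
  have hx' : x = 2 * x' + 1 by case: hx => // hx; exfalso; clear -s hx hy hz; lia.
  exists y, z, x'; rewrite -hx'; split; [by rewrite -s; ring | by rewrite N; ring |].
  by exists y', z'; left.
have hx' : x = 2 * x' by case: hx => // hx; exfalso; clear -s hx hy hz; lia.
exists x, z, y'; rewrite -hy; split; [by rewrite -s; ring | by rewrite N; ring |].
by exists x', z'; left.
Qed.

Lemma Q12_value_32p2 (p : nat) : prime p -> (p %% 6 = 5)%N -> Q12_value (2 ^+ 5 * (p ^ 2)%N%:Z).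
Proof.
move=> pp p5; have p3 : (3 < p)%N by clear -p5; lia.
have [z [w pzw]] := exists_sq_3sq pp p3.
have [|a [b [c [d pE]]]] := two_eisnorm_descent pp _ pzw; first by clear -p5; lia.
have eis3 a' b' : exists s, eisnorm a' b' = s ^+ 2 - 3 * (a' * b').
  by exists (a' + b'); rewrite /eisnorm; ring.
have sq3 (s : int) : exists t, s ^+ 2 = 3 * t \/ s ^+ 2 = 3 * t + 1.
  have [t [->|->|->]] := int_mod3 s.
  - by exists (3 * t ^+ 2); left; ring.
  - by exists (3 * t ^+ 2 + 2 * t); right; ring.
  - by exists (3 * t ^+ 2 + 4 * t + 1); right; ring.
have [n1 n2] : ~~ (3 %| eisnorm a b)%Z /\ ~~ (3 %| eisnorm c d)%Z.
  have [s sE] := eis3 a b; have [t tE] := eis3 c d.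
  have [s' hs] := sq3 s; have [t' ht] := sq3 t.
  move: pE; rewrite sE tE; move: (a * b) (c * d) => e f pE.
  by case: hs pE => ->; case: ht => -> pE; split; clear -p5 pE; lia.
have [x [y [k [s N P]]]] := eisnorm_triple n1.
have [x' [y' [k' [s' N' P']]]] := eisnorm_triple n2.
have key x1 y1 k1 x2 y2 k2 : 2 * x1 + 2 * y1 + (2 * k1 + 1) = 1 ->
    2 * x2 + 1 + (2 * y2 + 1) + (2 * k2 + 1) = 1 ->
    p%:Z = ((2 * x1) ^+ 2 + (2 * y1) ^+ 2 + (2 * k1 + 1) ^+ 2
             - 2 * x1 * (2 * y1) - 2 * x1 * (2 * k1 + 1) - 2 * y1 * (2 * k1 + 1))
         + ((2 * x2 + 1) ^+ 2 + (2 * y2 + 1) ^+ 2 + (2 * k2 + 1) ^+ 2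
             - (2 * x2 + 1) * (2 * y2 + 1) - (2 * x2 + 1) * (2 * k2 + 1)
             - (2 * y2 + 1) * (2 * k2 + 1)) ->
    Q12_value (2 ^+ 5 * (p ^ 2)%N%:Z).
  move=> s1 s2 E.
  have {s1}k1E : k1 = - x1 - y1 by clear -s1; lia.
  have {s2}k2E : k2 = - x2 - y2 - 1 by clear -s2; lia.
  rewrite -mulnn PoszM E k1E k2E.
  (* The sums of the triples are 5, 3, 1 and 1; the first two have norms 1 and 0. *)
  Q12_witness [:: 1 + x1; 1 + y1; 1 - x1 - y1] [:: 1 + x2; 1 + y2; - x2 - y2]
              [:: 1 - x1; 1 - y1; x1 + y1] [:: - x2; - y2; x2 + y2 + 1].
rewrite N N' in pE.
case: P => x1 [y1 h1]; case: P' => x2 [y2 h2].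
case: h1 s N pE => -[-> ->] s N; case: h2 s' N' => -[-> ->] s' N' pE.
- by exfalso; clear -p5 pE; lia.
- exact: key s s' pE.
- by apply: key s' s _; rewrite pE addrC.
by exfalso; clear -p5 pE; lia.
Qed.

Section Values.
Variable S : int -> Prop.
Hypotheses (S_mul : forall m n, S m -> S n -> S (m * n)) (Q12S : forall n, Q12_value n -> S n).

Lemma S_coprime6 m : coprimez m 6 -> S m.
Proof.
case/coprimez_6=> m2 m3.
have Sopp n : S n -> S (- n).
  move=> Sn; rewrite -mulN1r; apply: S_mul => //; apply: Q12S.
  Q12_witness (Nil int) [:: 1 : int] (Nil int) (Nil int).
have [t [h|[h|[h|h]]]] : exists t : int, m = 12 * t + 1 \/ m = 12 * t + 5 \/
    m = - (12 * t + 5) \/ m = - (12 * t + 1).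
  have [t [r [mE r12]]] : exists t r : int, m = 12 * t + r /\ 0 <= r < 12.
    by exists (m %/ 12)%Z, (m %% 12)%Z; clear; lia.
  have : [|| r == 1, r == 5, r == 7 | r == 11] by clear -mE r12 m2 m3; lia.
  case/or4P=> /eqP rE; [exists t | exists t | exists (- t - 1) | exists (- t - 1)];
    by clear -mE rE; lia.
- by rewrite h; apply/Q12S/Q12_value_1mod12.
- by rewrite h; apply/Q12S/Q12_value_5mod12.
- by rewrite h; apply/Sopp/Q12S/Q12_value_5mod12.
by rewrite h; apply/Sopp/Q12S/Q12_value_1mod12.
Qed.

Lemma S_pow2 a : [\/ a = 0, a = 4 | 6 <= a]%N -> S (2 ^+ a).
Proof.
have S1 : S 1 by apply: S_coprime6.
have S4 : S (2 ^+ 4) by apply: Q12S; Q12_witness [:: 0 : int; 1; 1] (Nil int) (Nil int) (Nil int).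
case=> [->|->|] //; elim/ltn_ind: a => a IHa a6.
have [a10|a10] := leqP 10 a.
  rewrite -(subnK (leq_trans (isT : 4 <= 10)%N a10)) exprD; apply: S_mul => //; apply: IHa; lia.
have : [|| a == 6, a == 7, a == 8 | a == 9]%N by lia.
case/or4P=> /eqP ->.
- by apply: Q12S; Q12_witness [:: 1 : int; 1; 1] (Nil int) [:: -1 : int] (Nil int).
- by apply: Q12S; Q12_witness [:: 1 : int; 1; 1] [:: 0 : int; 1; 1] [:: 1 : int; 1; 1] (Nil int).
- by rewrite (exprD _ 4 4); apply: S_mul.
- by apply: Q12S; Q12_witness [:: 0 : int; 1; 1] [:: 0 : int; -1] (Nil int) [:: 0 : int; 0; 1].
Qed.

Lemma S_pow3 b : b = 0%N \/ (3 <= b)%N -> S (3 ^+ b).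
Proof.
have S1 : S 1 by apply: S_coprime6.
have S3 : S (3 ^+ 3) by apply: Q12S; Q12_witness [:: 1 : int] [:: 1 : int] [:: 1 : int] (Nil int).
case=> [->|] //; elim/ltn_ind: b => b IHb b3.
have [b6|b6] := leqP 6 b.
  rewrite -(subnK b3) exprD; apply: S_mul => //; apply: IHb; lia.
have : [|| b == 3, b == 4 | b == 5]%N by lia.
case/or3P=> /eqP -> //.
- by apply: Q12S; Q12_witness [:: 1 : int; 0; 1] (Nil int) [:: -1 : int] (Nil int).
- by apply: Q12S; Q12_witness [:: 1 : int] [:: -1 : int; 1; -1] [:: 1 : int] [:: -1 : int; 1].
Qed.

Lemma S_32_pow3 b : b = 4%N \/ (6 <= b)%N -> S (2 ^+ 5 * 3 ^+ b).
Proof.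
have S4 : S (2 ^+ 5 * 3 ^+ 4).
  apply: Q12S; Q12_witness [:: 1 : int; 1; 2] [:: 1 : int; 1; 1]
                           [:: -1 : int; 0; -1] [:: -1 : int; -1; -1].
case=> [->|b6] //; have [->|b7] := eqVneq b 6%N.
  apply: Q12S; Q12_witness [:: 0 : int; 2; 2] [:: 1 : int; 1; 1]
                           [:: 0 : int; -1; -1] [:: -1 : int; -1; -1].
have -> : b = (4 + (b - 4))%N by lia.
by rewrite exprD mulrA; apply: S_mul => //; apply: S_pow3; right; lia.
Qed.

Lemma S_forms n : n = 0 \/ [\/ form_i n, form_ii n | form_iii n] -> S n.
Proof.
case=> [->|]; first by apply: Q12S; Q12_witness (Nil int) (Nil int) (Nil int) (Nil int).
case=> [[a [b [m [co ha hb ->]]]]|[b [m [co hb ->]]]|[b [p [k [m [co hb pp hk ->]]]]]].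
- by apply: S_mul; [apply: S_mul; [apply: S_pow2 | apply: S_pow3] | apply: S_coprime6].
- by apply: S_mul; [apply: S_32_pow3 | apply: S_coprime6].
rewrite (_ : _ * _ = (2 ^+ 5 * k%:Z) * 3 ^+ b * m); last by ring.
apply: S_mul; last exact: S_coprime6.
apply: S_mul; last by apply: S_pow3; case: hb => ->; auto.
by apply: Q12S; case: hk => -[-> hp]; [apply: Q12_value_32p | apply: Q12_value_32p2].
Qed.

End Values.

Theorem theorem5p1 (gT : finGroupType) (Q12 : {group gT}) (hQ12 : is_Q12 Q12)
    (n : int) :
  int_group_dets Q12 n <->
    n = 0%R \/ [\/ form_i n, form_ii n | form_iii n].
Proof.
have [a [b [defG a6 b2 ab oG]]] := is_Q12_gen hQ12.
have valE m := int_group_dets_Q12 defG a6 b2 ab oG m.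
split=> [/valE|]; first exact: Q12_value_forms.
by apply: S_forms => [m1 m2|m /valE //]; apply: int_group_dets_mul.
Qed.
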